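(* A hereditary family of graphs has the Erdős–Hajnal property if and only if it has the polynomial Rödl property.
   Context: A family of finite graphs is hereditary if it is closed under taking induced subgraphs. $\hom(G)$ is the size of a largest clique or independent set of $G$. A family $\mathcal{F}$ has the Erdős–Hajnal property if there is $c>0$ such that every $G\in\mathcal{F}$ on $n$ vertices has $\hom(G)\ge n^{c}$. A vertex set $S$ is $\varepsilon$-homogeneous if the edge density of $G[S]$ is at most $\varepsilon$ or at least $1-\varepsilon$. $\mathcal{F}$ has the polynomial Rödl property if there is $C$ such that for every $0<\varepsilon<1/2$, every $G\in\mathcal{F}$ on $n$ vertices has an $\varepsilon$-homogeneous set $S$ with $|S|\ge\varepsilon^{C}n$. *)

(* Defs.v *)
From mathcomp Require Import all_boot all_order all_algebra.
From mathcomp Require Import reals exp.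

Set Implicit Arguments.
Unset Strict Implicit.
Unset Printing Implicit Defensive.

Import Order.TTheory GRing.Theory Num.Theory.

Local Open Scope ring_scope.

Record sgraph := SGraph {
  vertex :> finType;
  adj : rel vertex;
  adj_sym : symmetric adj;
  adj_irrefl : irreflexive adj
}.

Definition edges (G : sgraph) : {set {set G}} :=
  [set e : {set G} | [exists x, exists y, adj x y && (e == [set x; y])]].

Section Induced.
Variables (G : sgraph) (S : {set G}).

Definition induced_adj : rel {x : G | x \in S} :=
  fun x y => adj (val x) (val y).

Lemma induced_adj_sym : symmetric induced_adj.
Proof. by move=> x y; apply: adj_sym. Qed.

Lemma induced_adj_irrefl : irreflexive induced_adj.
Proof. by move=> x; apply: adj_irrefl. Qed.

Definition induced : sgraph := SGraph induced_adj_sym induced_adj_irrefl.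

End Induced.

Definition clique (G : sgraph) (S : {set G}) : bool :=
  [forall x in S, forall y in S, (x != y) ==> adj x y].

Definition independent (G : sgraph) (S : {set G}) : bool :=
  [forall x in S, forall y in S, ~~ adj x y].

Definition hom_number (G : sgraph) : nat :=
  (\max_(S : {set G} | clique S || independent S) #|S|)%N.

(* Since 0^-1 = 0, a graph on at most one vertex has density 0; in particular
   singletons are eps-homogeneous for every eps >= 0. *)
Definition density (R : realType) (G : sgraph) : R :=
  #|edges G|%:R / 'C(#|G|, 2)%:R.

Definition homogeneous (R : realType) (eps : R) (G : sgraph) (S : {set G}) :
    Prop :=
  density R (induced S) <= eps \/ 1 - eps <= density R (induced S).

(* Closure under isomorphism is not required: all the properties below are
   isomorphism invariant, so families closed under isomorphism are a special
   case. *)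
Definition hereditary (F : sgraph -> Prop) : Prop :=
  forall (G : sgraph) (S : {set G}), F G -> F (induced S).

Definition erdos_hajnal (R : realType) (F : sgraph -> Prop) : Prop :=
  exists c : R, 0 < c /\
    forall G : sgraph, F G -> (#|G|%:R : R) `^ c <= (hom_number G)%:R.

Definition polynomial_rodl (R : realType) (F : sgraph -> Prop) : Prop :=
  exists C : R, forall eps : R, 0 < eps -> eps < 2^-1 ->
    forall G : sgraph, F G ->
    exists S : {set G}, homogeneous eps S /\ eps `^ C * #|G|%:R <= #|S|%:R.

(* Main.v *)
(* From Erdos-Hajnal to polynomial Rodl: double counting over the vertex sets
   of size [m = k ^ N], all of which contain a homogeneous [k]-set, shows that
   [G] or its complement has at least [(n / m) ^ k / 2] ordered [k]-cliques.
   Let [v_1, ..., v_k] be a uniformly random one.  Its entropy is within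
   [O(k log m)] of the maximum [k log n], so for some [i < k / 2] the entropy of
   [v_i+1] given the past is [log n - O(log m)] while the mutual information of
   [v_i+1] and [v_i+2] given the past is [O(log m / k)].  As these two vertices
   have the same conditional distribution [mu] and are always adjacent, for
   some value of the past [mu * mu] gives only mass [O(log m / k)] to the
   non-edges, and [mu] is close to uniform on [n / poly m] vertices.  Truncating
   the heavy atoms and rounding [mu] to a set gives the near-clique; taking [k]
   quadratic in [1 / eps] makes its density at least [1 - eps].
   The converse applies the Rodl property with [eps] a small power of [1 / n],
   followed by a Turan-type bound. *)

Require Import Defs.
From mathcomp Require Import all_boot all_order all_algebra.
From mathcomp Require Import reals sequences exp.
From mathcomp Require Import ring lra zify.

Set Implicit Arguments.
Unset Strict Implicit.
Unset Printing Implicit Defensive.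

Import Order.TTheory GRing.Theory Num.Theory.

Local Open Scope ring_scope.

(** * Entropy inequalities for unnormalized weights *)

Lemma ln_le_sub1 (R : realType) (x : R) : 0 < x -> ln x <= x - 1.
Proof.
move=> x0; have /le_ln1Dx : -1 < x - 1 by lra.
by rewrite addrC subrK.
Qed.

(** Termwise form of Gibbs' inequality, from [ln (y / x) <= y / x - 1]. The last hypothesis is
    absolute continuity: at [y = 0] the right-hand side is [0] by the conventions on division. *)
Lemma xln_div_ge (R : realType) (x y : R) :
  0 <= x -> 0 <= y -> (y = 0 -> x = 0) -> x - y <= x * ln (x / y).
Proof.
rewrite le_eqVlt => /predU1P[<- y0 _|x0]; first by rewrite mul0r; lra.
rewrite le_eqVlt => /predU1P[<- /(_ erefl) x_eq0|y0 _].
  by move: x0; rewrite x_eq0 ltxx.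
have /ln_le_sub1 le_ln : 0 < y / x by rewrite divr_gt0.
have -> : ln (x / y) = - ln (y / x).
  by rewrite -lnV ?posrE ?divr_gt0// invf_div.
have := ler_wpM2l (ltW x0) le_ln.
by rewrite mulrBr mulr1 mulrCA divff ?gt_eqF// mulr1; lra.
Qed.

Definition xlnx (R : realType) (x : R) : R := x * ln x.

(* Mutual information of a pair with joint weights [b] supported on [e] and
   both marginals [a]: it is at least the mass which the product of the
   marginals puts outside [e]. *)
Lemma mutual_information_ge (R : realType) (V : finType) (e : rel V)
    (b : V -> V -> R) (a : V -> R) :
  (forall v w, 0 <= b v w) -> (forall v w, ~~ e v w -> b v w = 0) ->
  (forall v, a v = \sum_w b v w) -> (forall w, a w = \sum_v b v w) ->
  (\sum_v \sum_w (~~ e v w)%:R * (a v * a w)) / (\sum_v a v) <=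
  \sum_v \sum_w xlnx (b v w) - (\sum_v xlnx (a v)) *+ 2 + xlnx (\sum_v a v).
Proof.
move=> b0 be ar al; set c := \sum_v a v.
have a0 v : 0 <= a v by rewrite ar sumr_ge0.
have c0 : 0 <= c by rewrite sumr_ge0.
have -> : \sum_v \sum_w xlnx (b v w) - (\sum_v xlnx (a v)) *+ 2 + xlnx c =
    \sum_v \sum_w b v w * (ln (b v w) - ln (a v) - ln (a w) + ln c).
  under [RHS]eq_bigr do
    (under eq_bigr do rewrite mulrDr !mulrBr; rewrite big_split/= !sumrB
      -!mulr_suml -ar).
  rewrite big_split/= !sumrB -mulr_suml.
  rewrite [X in _ = _ - X + _]exchange_big/=.
  under [X in _ = _ - X + _]eq_bigr do rewrite -mulr_suml -al.
  by rewrite /xlnx mulr2n opprD addrA.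
(* The weights [b v w] and [a v * a w / c] have the same total, so their difference can be inserted
   freely; the inequality then holds term by term. *)
have -> : (\sum_v \sum_w (~~ e v w)%:R * (a v * a w)) / c =
    \sum_v \sum_w (b v w - a v * a w / c + (~~ e v w)%:R * (a v * a w) / c).
  under [RHS]eq_bigr do rewrite big_split/= sumrB -ar -!mulr_suml -mulr_sumr.
  rewrite big_split/= sumrB -!mulr_suml -/c.
  have [->|cn0] := eqVneq c 0; first by rewrite !mul0r subrr add0r.
  by rewrite mulfK// subrr add0r.
apply: ler_sum => v _; apply: ler_sum => w _.
have [b_eq0|bn0] := eqVneq (b v w) 0.
  rewrite b_eq0 mul0r; have : 0 <= a v * a w / c by rewrite !mulr_ge0// invr_ge0.
  by case: (e v w) => /=; rewrite ?mul0r ?mul1r; lra.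
have -> : e v w by apply: contraNT bn0 => /be ->.
have bpos : 0 < b v w by rewrite lt_def bn0 b0.
have av : 0 < a v.
  apply: (lt_le_trans bpos); rewrite ar (bigD1 w)//= lerDl.
  by rewrite sumr_ge0.
have aw : 0 < a w.
  apply: (lt_le_trans bpos); rewrite al (bigD1 v)//= lerDl.
  by rewrite sumr_ge0.
have cpos : 0 < c.
  apply: (lt_le_trans av); rewrite /c (bigD1 v)//= lerDl.
  by rewrite sumr_ge0.
have ypos : 0 < a v * a w / c by rewrite divr_gt0// mulr_gt0.
rewrite !mul0r addr0.
have := @xln_div_ge _ (b v w) (a v * a w / c) (ltW bpos) (ltW ypos).
rewrite !(ln_div, lnM) ?posrE ?mulr_gt0 ?invr_gt0// => /(_ _)/le_trans; apply.
  by move=> y_eq0; move: ypos; rewrite y_eq0 ltxx.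
by rewrite ler_wpM2l//; lra.
Qed.

(* [c] times the relative entropy of [a / c] with respect to the uniform
   distribution, where [c] is the total mass of [a]. *)
Definition entropy_defect (R : realType) (V : finType) (a : V -> R) : R :=
  (\sum_v a v) * ln #|V|%:R - xlnx (\sum_v a v) + \sum_v xlnx (a v).

Lemma entropy_defectE (R : realType) (V : finType) (a : V -> R) :
  (forall v, 0 <= a v) ->
  entropy_defect a =
  \sum_v a v * ln (a v / ((\sum_v a v) / #|V|%:R)).
Proof.
move=> a0; rewrite /entropy_defect; set c := \sum_v a v; set n : R := #|V|%:R.
rewrite {1}/c /xlnx mulr_suml [c * _]mulr_suml -sumrB -big_split/=.
apply: eq_bigr => v _; have [->|avn0] := eqVneq (a v) 0.
  by rewrite !mul0r subrr addr0.
have av : 0 < a v by rewrite lt_def avn0 a0.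
have cpos : 0 < c.
  apply: (lt_le_trans av); rewrite /c (bigD1 v)//= lerDl.
  by rewrite sumr_ge0.
have n0 : 0 < n by rewrite ltr0n; apply/card_gt0P; exists v.
by rewrite invf_div mulrA ln_div ?lnM ?posrE ?mulr_gt0//; ring.
Qed.

Lemma entropy_term_ge (R : realType) (V : finType) (a : V -> R) (v : V) :
  (forall v, 0 <= a v) ->
  a v - (\sum_v a v) / #|V|%:R <= a v * ln (a v / ((\sum_v a v) / #|V|%:R)).
Proof.
move=> a0; apply: xln_div_ge => //.
  by rewrite mulr_ge0 ?invr_ge0// sumr_ge0.
move/eqP; rewrite mulf_eq0 invr_eq0 pnatr_eq0 => /orP[|/eqP/card0_eq/(_ v)//].
by rewrite psumr_eq0// => /allP/(_ v)/(_ (mem_index_enum _))/eqP.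
Qed.

Lemma entropy_defect_ge0 (R : realType) (V : finType) (a : V -> R) :
  (forall v, 0 <= a v) -> 0 <= entropy_defect a.
Proof.
move=> a0; rewrite entropy_defectE//.
apply: le_trans (ler_sum _ (fun v _ => entropy_term_ge v a0)).
rewrite sumrB sumr_const -[_ *+ _]mulr_natr subr_ge0.
have [->|n0] := eqVneq (#|V|%:R : R) 0; last by rewrite divfK.
by rewrite mulr0 sumr_ge0.
Qed.

(** Write [c] for the total mass. A heavy atom exceeds [M] times the uniform weight [c / #|V|], so
    its term in the relative entropy is at least [a v * ln M]. The other terms may be negative, but
    not below [- c / #|V|]; the mass added on the right pays for them. *)
Lemma heavy_mass_le (R : realType) (V : finType) (a : V -> R) (M : R) :
  (forall v, 0 <= a v) -> 0 < M ->
  (\sum_(v | M * (\sum_v a v) < a v * #|V|%:R) a v) * ln M <=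
  entropy_defect a + \sum_v a v.
Proof.
move=> a0 M0; set c := \sum_v a v; set n : R := #|V|%:R.
have c0 : 0 <= c by rewrite sumr_ge0.
have n0 : 0 <= n by rewrite ler0n.
have cn0 : 0 <= c / n by rewrite divr_ge0.
have cE : \sum_(v : V) c / n <= c.
  rewrite sumr_const -[_ *+ _]mulr_natr -/n.
  by have [->|n_neq0] := eqVneq n 0; rewrite ?mulr0// divfK.
rewrite entropy_defectE// -/c -/n.
apply: le_trans (lerD (lexx _) cE); rewrite -big_split/=.
rewrite mulr_suml big_mkcond/=; apply: ler_sum => v _.
case: ifPn => [heavy|_]; last first.
  have := entropy_term_ge v a0; rewrite -/c -/n.
  by have := a0 v; lra.
apply: ler_wpDr => //; rewrite ler_wpM2l//.
have av_n : 0 < a v * n by rewrite (le_lt_trans _ heavy)// mulr_ge0// ltW.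
have av : 0 < a v by rewrite lt_def a0 andbT; apply: contraTneq av_n => ->; rewrite mul0r ltxx.
have npos : 0 < n by rewrite -(pmulr_rgt0 _ av).
have cpos : 0 < c.
  apply: (lt_le_trans av); rewrite /c (bigD1 v)//= lerDl.
  by rewrite sumr_ge0.
rewrite invf_div mulrA ler_ln ?posrE ?divr_gt0// ler_pdivlMr//.
exact: ltW.
Qed.

(** * Counting ordered cliques with a prescribed beginning *)

Fixpoint words (V : finType) (k : nat) : seq (seq V) :=
  if k is k'.+1 then [seq v :: s | s <- words V k', v <- enum V] else [:: [::]].

(** Unnormalized law of a random ordered [k]-clique: for [s] of size [i], [extensions e (k - i) s]
    over [extensions e k [::]] is the probability that its past is [s]. Words grow at the head, so
    the latest vertex comes first. *)
Fixpoint extensions (V : finType) (e : rel V) (j : nat) (s : seq V) : nat :=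
  if j is j'.+1 then \sum_v extensions e j' (v :: s) else pairwise e s.

Lemma words_sum (R : nmodType) (V : finType) (k : nat) (f : seq V -> R) :
  \sum_(s <- words V k.+1) f s = \sum_(s <- words V k) \sum_v f (v :: s).
Proof.
by rewrite /= big_allpairs_dep; apply: eq_bigr => s _; rewrite big_enum.
Qed.

Lemma pairwise_perm (T : eqType) (e : rel T) (s t : seq T) :
  symmetric e -> perm_eq s t -> pairwise e s = pairwise e t.
Proof.
move=> e_sym; elim: s t => [|x s IHs] t; first by rewrite perm_sym => /perm_nilP->.
move=> st; have xt : x \in t by rewrite -(perm_mem st) mem_head.
case/splitPr: xt st => t1 t2; rewrite perm_sym perm_catC /= perm_cons.
rewrite perm_catC perm_sym => st.
rewrite /= pairwise_cat /= allrel_consr (IHs _ st) pairwise_cat.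
rewrite (perm_all _ st) all_cat.
have -> : all (e^~ x) t1 = all (e x) t1 by apply: eq_all => y; rewrite e_sym.
by case: (all (e x) t1); case: (all (e x) t2); rewrite ?andbF ?andbT.
Qed.

Lemma extensions_perm (V : finType) (e : rel V) (j : nat) (s t : seq V) :
  symmetric e -> perm_eq s t -> extensions e j s = extensions e j t.
Proof.
move=> e_sym; elim: j s t => [|j IHj] s t st /=; first by rewrite (pairwise_perm e_sym st).
by apply: eq_bigr => v _; apply: IHj; rewrite perm_cons.
Qed.

Lemma extensions_eq0 (V : finType) (e : rel V) (j : nat) (s : seq V) :
  ~~ pairwise e s -> extensions e j s = 0%N.
Proof.
elim: j s => [|j IHj] s sN /=; first by rewrite (negbTE sN).
by rewrite big1// => v _; apply: IHj; rewrite /= negb_and sN orbT.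
Qed.

Lemma extensions_words (V : finType) (e : rel V) (i j : nat) :
  (\sum_(s <- words V i) extensions e j s)%N = extensions e (i + j) [::].
Proof.
elim: i j => [|i IHi] j; first by rewrite big_seq1.
by rewrite addSnnS -IHi words_sum.
Qed.

Lemma mem_words (V : finType) (s : seq V) : s \in words V (size s).
Proof.
elim: s => //= v s IHs; apply/allpairsP; exists (s, v).
by rewrite /= IHs mem_enum.
Qed.

(** Each clique is counted through the single ordering [enum B]; the gain of a factor [k!] is given
    up. *)
Lemma card_cliques_le_extensions (V : finType) (e : rel V) (k : nat) :
  (#|[set B : {set V} | pairwise e (enum B) & #|B| == k]| <= extensions e k [::])%N.
Proof.
rewrite -[k in extensions _ k]addn0 -extensions_words /=.
have -> : (\sum_(s <- words V k) pairwise e s = count (pairwise e) (words V k))%N.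
  by rewrite -sum1_count [RHS]big_mkcond; apply: eq_bigr => s _; case: pairwise.
rewrite -size_filter cardE -(size_map (fun B : {set V} => enum B)).
apply: uniq_leq_size.
  rewrite map_inj_uniq ?enum_uniq// => B B' BB'.
  by apply/setP => x; rewrite -mem_enum BB' mem_enum.
move=> t /mapP[B]; rewrite mem_enum inE => /andP[Be /eqP Bk] ->.
by rewrite mem_filter Be -Bk cardE mem_words.
Qed.

(** * Averaging and rounding *)

(** By monotonicity [D q] is at most the average over the second half, hence at most [X]. So [D]
    rises by at most [X] during the first [q] steps, and one of these rises by at most
    [X / q%:R]. *)
Lemma exists_slow_index (R : realFieldType) (D : nat -> R) (q : nat) (X : R) :
  (0 < q)%N -> (forall i, 0 <= D i) ->
  (forall i, (i.+1 < q.*2)%N -> D i <= D i.+1) ->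
  \sum_(i < q.*2) D i <= q%:R * X ->
  exists i, [/\ (i < q)%N, D i <= X & D i.+1 - D i <= X / q%:R].
Proof.
move=> q0 D0 Dmono Dsum.
have D_le i j : (i <= j < q.*2)%N -> D i <= D j.
  case/andP; elim: j => [|j IHj]; first by rewrite leqn0 => /eqP->.
  rewrite leq_eqVlt => /predU1P[->//|ij] jq.
  exact: le_trans (IHj ij (ltnW jq)) (Dmono _ jq).
have q_lt : (q < q.*2)%N by rewrite -addnn -{1}[q]addn0 ltn_add2l.
have qR : 0 < q%:R :> R by rewrite ltr0n.
have Dq : D q <= X.
  rewrite -(ler_pM2l qR); apply: le_trans Dsum.
  rewrite -(big_mkord xpredT) (@big_cat_nat _ _ _ q)//= ?(ltnW q_lt)//.
  apply: ler_wpDl; first by rewrite sumr_ge0.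
  rewrite mulr_natl -[q in _ *+ q](addnK q) addnn -sumr_const_nat.
  rewrite [leLHS]big_nat_cond [leRHS]big_nat_cond.
  by apply: ler_sum => i; rewrite andbT => /D_le.
case: (boolP [exists i : 'I_q, D i.+1 - D i <= X / q%:R]) => [/existsP[i Hi]|].
  exists i; split=> //; apply: le_trans Dq.
  by apply: D_le; rewrite (ltnW (ltn_ord i)).
rewrite negb_exists => /forallP Hlt.
have : q%:R * (X / q%:R) < D q - D 0%N.
  rewrite -(telescope_sumr D (leq0n q)) mulr_natl -[q in _ *+ q]subn0.
  rewrite -sumr_const_nat !big_mkord.
  apply: ltr_sum; last by move=> i _; rewrite ltNge Hlt.
  by apply/hasP; exists (Ordinal q0); rewrite ?mem_index_enum.
by rewrite mulrC divfK ?gt_eqF// ltNge; have := D0 0%N; lra.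
Qed.

(** Without its diagonal the form is affine in each weight separately, so the weights can be moved
    to [0] or [1] one by one without decreasing it. *)
Lemma quadratic_rounding (R : realFieldType) (V : finType) (B : V -> V -> R)
    (p : V -> R) :
  (forall v, 0 <= p v <= 1) ->
  exists S : {set V},
    \sum_v \sum_(w | w != v) B v w * (p v * p w) <=
    \sum_(v in S) \sum_(w in S | w != v) B v w.
Proof.
pose Q p := \sum_v \sum_(w | w != v) B v w * (p v * p w).
pose upd (p : V -> R) x (r : R) := fun v => if v == x then r else p v.
have Q_affine r x : Q r = r x * Q (upd r x 1) + (1 - r x) * Q (upd r x 0).
  rewrite /Q !mulr_sumr -big_split; apply: eq_bigr => v _ /=.
  rewrite !mulr_sumr -big_split; apply: eq_bigr => w /= wv; rewrite /upd.
  have [vx|vx] := eqVneq v x; last by case: eqVneq => [->|_]; ring.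
  by rewrite -vx (negbTE wv); ring.
move=> p01.
have [r [r01 pr]] : exists r, (forall v, v \in enum V -> r v = 0 \/ r v = 1) /\ Q p <= Q r.
  suff [r []] : exists r, [/\ forall v, v \in enum V -> r v = 0 \/ r v = 1,
    forall v, 0 <= r v <= 1 & Q p <= Q r] by exists r.
  elim: (enum V) => [|x s [r [rs r01 pr]]]; first by exists p; split.
  pose r' := if Q (upd r x 1) <= Q (upd r x 0) then upd r x 0 else upd r x 1.
  exists r'; split=> [v|v|].
  - by rewrite inE /r'; case: ifP => _; rewrite /upd; case: eqP => //= _;
      auto.
  - by rewrite /r'; case: ifP => _; rewrite /upd; case: eqP => // _;
      rewrite !lexx ler01.
  - apply: (le_trans pr); rewrite (Q_affine r x) /r'.
    have conv (a b t : R) : 0 <= t <= 1 -> t * a + (1 - t) * b <= Num.max a b.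
      case/andP=> t0 t1; rewrite -[leRHS]mul1r -[X in X * Num.max _ _](subrKC t).
      by rewrite [leRHS]mulrDl lerD// ler_wpM2l ?subr_ge0// le_max lexx ?orbT.
    apply: (le_trans (conv _ _ _ (r01 x))).
    by case: (leP (Q (upd r x 1)) (Q (upd r x 0))) => _; apply: lexx.
exists [set v | r v == 1]; apply: (le_trans pr); rewrite /Q.
have rE v : r v = (v \in [set v | r v == 1])%:R.
  rewrite inE; have [->|->] := r01 v (mem_enum _ _); last by rewrite eqxx.
  by rewrite eq_sym oner_eq0.
rewrite [leRHS]big_mkcond; apply: ler_sum => v _ /=.
case: ifP => vS; last first.
  by rewrite big1// => w _; rewrite rE vS mul0r mulr0.
rewrite big_mkcondl; apply: ler_sum => w _.
by rewrite (rE v) (rE w) vS mul1r; case: (w \in _); rewrite ?mulr1 ?mulr0.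
Qed.

(** One form, with coefficients [eps - (~~ e v w)%:R], controls both density and size. Its value on
    [S] is [eps * (#|S| * #|S|.-1)%:R] minus the number of non-edges, and rounding makes it at least
    [eps / 2 * (\sum_v p v) ^+ 2]. *)
Lemma near_clique_rounding (R : realFieldType) (V : finType) (e : rel V)
    (eps : R) (p : V -> R) :
  irreflexive e -> 0 < eps -> eps <= 1 -> (forall v, 0 <= p v <= 1) ->
  \sum_v \sum_w (~~ e v w)%:R * (p v * p w) <= eps / 2 * (\sum_v p v) ^+ 2 ->
  exists S : {set V},
    \sum_(v in S) \sum_(w in S | w != v) (~~ e v w)%:R <=
      eps * (#|S| * #|S|.-1)%:R /\
    (\sum_v p v) ^+ 2 <= 2 * #|S|%:R ^+ 2.
Proof.
move=> e_irr eps0 eps1 p01 p_sparse.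
have [S] := quadratic_rounding (fun v w => eps - (~~ e v w)%:R) p01.
move=> QS; exists S; set X := \sum_v p v.
set N := \sum_(v in S) \sum_(w in S | w != v) (~~ e v w)%:R.
have QN : \sum_(v in S) \sum_(w in S | w != v) (eps - (~~ e v w)%:R) =
    eps * (#|S| * #|S|.-1)%:R - N.
  under eq_bigr do rewrite sumrB.
  rewrite sumrB; congr (_ - _).
  under eq_bigr => v vS.
    rewrite sumr_const (_ : #|_| = #|S|.-1); last first.
      rewrite (cardsD1 v S) vS /= -cardsE; apply: eq_card => w.
      by rewrite !inE andbC.
    over.
  by rewrite sumr_const -mulrnA mulr_natr mulnC.
have Q_ge : eps / 2 * X ^+ 2 <=
    \sum_v \sum_(w | w != v) (eps - (~~ e v w)%:R) * (p v * p w).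
  apply: (@le_trans _ _
    (\sum_v \sum_w (eps - (~~ e v w)%:R) * (p v * p w))); last first.
    (* Since [e] is irreflexive, the diagonal coefficients are [eps - 1 <= 0], and dropping them can
       only increase the sum. *)
    apply: ler_sum => v _; rewrite (bigD1 v)//= gerDr e_irr /=.
    by rewrite mulr_le0_ge0 ?subr_le0// mulr_ge0//; case/andP: (p01 v).
  under eq_bigr do (under eq_bigr do rewrite mulrBl; rewrite sumrB).
  have -> : X ^+ 2 = \sum_v \sum_w p v * p w.
    by rewrite expr2 /X mulr_suml; apply: eq_bigr => v _; rewrite mulr_sumr.
  have XE : \sum_v \sum_w eps * (p v * p w) = eps * X ^+ 2.
    rewrite expr2 /X mulr_suml mulr_sumr; apply: eq_bigr => v _.
    by rewrite !mulr_sumr.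
  rewrite sumrB XE; move: p_sparse; rewrite -/X.
  have -> : \sum_v \sum_w p v * p w = X ^+ 2.
    by rewrite expr2 /X mulr_suml; apply: eq_bigr => v _; rewrite mulr_sumr.
  lra.
have := le_trans Q_ge QS; rewrite QN => main.
have X0 : 0 <= X ^+ 2 by rewrite sqr_ge0.
have N0 : 0 <= N by rewrite sumr_ge0// => v _; rewrite sumr_ge0.
have epsX : 0 <= eps / 2 * X ^+ 2 by rewrite mulr_ge0// divr_ge0// ltW.
split; first by lra.
have s_le : (#|S| * #|S|.-1)%:R <= #|S|%:R ^+ 2 :> R.
  by rewrite -natrX ler_nat expnS expn1 leq_mul2l leq_pred orbT.
rewrite -(ler_pM2l eps0); have := ler_wpM2l (ltW eps0) s_le; lra.
Qed.

(** * Conditional entropies of a random ordered clique *)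

(* [entropy_loss i] is [T (ln n - H_i)], where [T] is the number of ordered
   [k]-cliques and [H_i] is the entropy of the vertex number [i.+1] of a random
   one conditionally on the [i] previous vertices. *)
Definition entropy_loss (R : realType) (V : finType) (e : rel V) (k i : nat) : R :=
  \sum_(s <- words V i)
    entropy_defect (fun v => (extensions e (k - i.+1) (v :: s))%:R : R).

Lemma extensions_natr_sum (R : realType) (V : finType) (e : rel V) (k i : nat)
    (s : seq V) :
  (i < k)%N ->
  \sum_v (extensions e (k - i.+1) (v :: s))%:R = (extensions e (k - i) s)%:R :> R.
Proof. by move=> ik; rewrite -natr_sum -[in RHS]subnSK. Qed.

(** In this form the losses telescope when summed over [i], and the difference of two consecutive
    losses is a second difference of sums of [xlnx]. *)
Lemma entropy_lossE (R : realType) (V : finType) (e : rel V) (k i : nat) :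
  (i < k)%N ->
  entropy_loss R e k i =
  (extensions e k [::])%:R * ln #|V|%:R
  - \sum_(s <- words V i) xlnx (extensions e (k - i) s)%:R
  + \sum_(s <- words V i.+1) xlnx (extensions e (k - i.+1) s)%:R.
Proof.
move=> ik; rewrite words_sum /entropy_loss /entropy_defect.
under eq_bigr do rewrite (extensions_natr_sum _ _ _ ik).
rewrite big_split/= sumrB -mulr_suml -natr_sum extensions_words.
by rewrite subnKC// ltnW.
Qed.

Lemma entropy_loss_ge0 (R : realType) (V : finType) (e : rel V) (k i : nat) :
  0 <= entropy_loss R e k i.
Proof. by apply: sumr_ge0 => s _; apply: entropy_defect_ge0. Qed.

(** The difference is the conditional mutual information of the next two vertices given the past. By
    symmetry of [e] they are exchangeable, so the two marginals agree and [mutual_information_ge]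
    applies to each past. *)
Lemma entropy_loss_step (R : realType) (V : finType) (e : rel V) (k i : nat) :
  symmetric e -> (i.+1 < k)%N ->
  \sum_(s <- words V i)
    (\sum_v \sum_w (~~ e v w)%:R * ((extensions e (k - i.+1) (v :: s))%:R *
                                    (extensions e (k - i.+1) (w :: s))%:R))
      / (extensions e (k - i) s)%:R <=
  entropy_loss R e k i.+1 - entropy_loss R e k i.
Proof.
move=> e_sym ik; rewrite !entropy_lossE// 1?ltnW//.
set T := (extensions e k [::])%:R * _.
have -> (a b c : R) : T - a + b - (T - c + a) = b - a *+ 2 + c by ring.
rewrite !words_sum -sumrMnl -sumrB -big_split/=; apply: ler_sum => s _.
have ik' := ltnW ik.
rewrite -(extensions_natr_sum R e s ik').
have := @mutual_information_ge R V e
  (fun v w => (extensions e (k - i.+2) (w :: v :: s))%:R)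
  (fun v => (extensions e (k - i.+1) (v :: s))%:R).
apply=> // [v w evw|v|w].
- rewrite extensions_eq0//=.
  by rewrite (e_sym w v) (negbTE evw).
- by rewrite extensions_natr_sum.
- rewrite -extensions_natr_sum//; apply: eq_bigr => v _; congr (_%:R).
  apply: extensions_perm => //.
  by rewrite -[v :: w :: s]/([:: v] ++ [:: w] ++ s) perm_catCA.
Qed.

(** Chain rule: the conditional entropies add up to the logarithm of the number of ordered
    cliques. *)
Lemma entropy_loss_total (R : realType) (V : finType) (e : rel V) (k : nat) :
  \sum_(i < k) entropy_loss R e k i =
  (extensions e k [::])%:R * (ln #|V|%:R *+ k - ln (extensions e k [::])%:R).
Proof.
set T := (extensions e k [::])%:R : R.
pose L i : R := \sum_(s <- words V i) xlnx (extensions e (k - i) s)%:R.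
under eq_bigr do rewrite entropy_lossE ?ltn_ord//.
under eq_bigr do rewrite -addrA -/T -/(L _) [- _ + _]addrC.
rewrite big_split/= sumr_const card_ord.
rewrite -(big_mkord xpredT (fun i => L i.+1 - L i)) telescope_sumr//.
(* For complete words the counts are [0] or [1], and [xlnx] vanishes at both. *)
have -> : L k = 0.
  rewrite /L subnn big1// => s _ /=; case: pairwise; rewrite /xlnx.
    by rewrite ln1 mulr0.
  by rewrite mul0r.
by rewrite /L big_seq1 subn0 /xlnx -/T mulrBr mulrnAr sub0r.
Qed.

(** The sum of [3 * c i - f i / X - g i / Y] is at least that of [c], hence positive; an index with
    a positive term meets all three conditions. *)
Lemma exists_below_averages (R : realFieldType) (I : eqType) (r : seq I) (c f g : I -> R)
    (X Y : R) :
  (forall i, 0 <= f i) -> (forall i, 0 <= g i) ->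
  0 < X -> 0 < Y -> 0 < \sum_(i <- r) c i ->
  \sum_(i <- r) f i <= X * \sum_(i <- r) c i ->
  \sum_(i <- r) g i <= Y * \sum_(i <- r) c i ->
  exists i, [/\ 0 < c i, f i <= 3 * X * c i & g i <= 3 * Y * c i].
Proof.
move=> f0 g0 X0 Y0 C0 fX gY.
pose h i := 3 * c i - f i / X - g i / Y.
have hsum : 0 < \sum_(i <- r) h i.
  rewrite !sumrB -mulr_sumr -!mulr_suml.
  have : (\sum_(i <- r) f i) / X <= \sum_(i <- r) c i by rewrite ler_pdivrMr// mulrC.
  have : (\sum_(i <- r) g i) / Y <= \sum_(i <- r) c i by rewrite ler_pdivrMr// mulrC.
  lra.
have [/hasP[i _ hi]|/hasPn hle] := boolP (has (fun i => 0 < h i) r).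
  have fi : 0 <= f i / X by rewrite divr_ge0 ?f0 ?ltW.
  have gi : 0 <= g i / Y by rewrite divr_ge0 ?g0 ?ltW.
  exists i; rewrite /h in hi; split; first by lra.
    by rewrite mulrAC -ler_pdivrMr//; lra.
  by rewrite mulrAC -ler_pdivrMr//; lra.
move: hsum; rewrite big_seq ltNge sumr_le0// => i /hle.
by rewrite -leNgt.
Qed.

Lemma near_clique_of_many_cliques (R : realType) (V : finType) (e : rel V)
    (eps m : R) (q : nat) :
  symmetric e -> irreflexive e -> 0 < eps -> eps <= 1 -> (0 < q)%N -> 1 <= m ->
  (0 < #|V|)%N ->
  48 * (ln m + 1) <= q%:R * eps ->
  (#|V|%:R / m) ^+ q.*2 <= 2 * (extensions e q.*2 [::])%:R ->
  exists S : {set V},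
    \sum_(v in S) \sum_(w in S | w != v) (~~ e v w)%:R <=
      eps * (#|S| * #|S|.-1)%:R /\
    #|V|%:R <= 3 * expR (12 * (ln m + 1) + 2) * #|S|%:R.
Proof.
move=> e_sym e_irr eps0 eps1 q0 m1 V0 q_large many.
set T : R := (extensions e q.*2 [::])%:R; set n : R := #|V|%:R.
set Y := ln m + 1; set M := expR (12 * Y + 2).
have n0 : 0 < n by rewrite ltr0n.
have m0 : 0 < m by rewrite (lt_le_trans ltr01).
have Y1 : 1 <= Y by rewrite lerDr ln_ge0.
have Y0 : 0 < Y by rewrite (lt_le_trans ltr01).
have qR : 0 < q%:R :> R by rewrite ltr0n.
have M0 : 0 < M by apply: expR_gt0.
have nm0 : 0 < (n / m) ^+ q.*2 by rewrite exprn_gt0 ?divr_gt0.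
have T0 : 0 < T by move: many; rewrite -/T -/n; lra.
(* The [+ 1] in [Y] absorbs the [ln 2] coming from the factor [2] in the hypothesis [many]. *)
have loss_total : \sum_(i < q.*2) entropy_loss R e q.*2 i <= q%:R * (2 * Y * T).
  rewrite entropy_loss_total -/T -/n.
  have lnT : (ln n - ln m) *+ q.*2 <= ln 2 + ln T.
    rewrite -lnM ?posrE// -ln_div ?posrE// -lnXn ?divr_gt0//.
    by rewrite ler_ln ?posrE ?mulr_gt0.
  have ln2 : ln (2 : R) <= q.*2%:R.
    apply: le_trans (_ : 2 - 1 <= _); first exact: ln_le_sub1.
    have : 1 <= q.*2%:R :> R by rewrite ler1n double_gt0.
    lra.
  have -> : q%:R * (2 * Y * T) = T * (ln m *+ q.*2 + q.*2%:R).
    by rewrite -mulr_natr -[q.*2]muln2 natrM /Y; ring.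
  rewrite ler_pM2l//; move: lnT; rewrite mulrnBl; lra.
have loss_mono i : (i.+1 < q.*2)%N ->
    entropy_loss R e q.*2 i <= entropy_loss R e q.*2 i.+1.
  move=> ik; rewrite -subr_ge0; apply: le_trans (entropy_loss_step R e_sym ik).
  apply: sumr_ge0 => s _; rewrite divr_ge0//.
  by apply: sumr_ge0 => v _; apply: sumr_ge0 => w _; rewrite !mulr_ge0.
have [i [iq loss_i step_i]] := exists_slow_index q0
  (fun i => entropy_loss_ge0 R e q.*2 i) loss_mono loss_total.
have ik : (i.+1 < q.*2)%N by rewrite -addnn -addn1 leq_add.
have words_T : \sum_(s <- words V i) (extensions e (q.*2 - i) s)%:R = T.
  by rewrite -natr_sum extensions_words subnKC// ltnW// ltnW.
have Yq0 : 0 < 2 * Y / q%:R by rewrite divr_gt0// mulr_gt0.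
have step_le := le_trans (entropy_loss_step R e_sym ik) step_i.
pose a s v : R := (extensions e (q.*2 - i.+1) (v :: s))%:R.
(* This fixes a past [s] of positive weight for which both the entropy defect of the next vertex and
   the non-edge mass are within a factor [3] of their average bounds. *)
have [s|s||||||s [cs def_s step_s]] := @exists_below_averages R _ (words V i)
  (fun s => (extensions e (q.*2 - i) s)%:R) (fun s => entropy_defect (a s))
  (fun s => (\sum_v \sum_w (~~ e v w)%:R * (a s v * a s w))
             / (extensions e (q.*2 - i) s)%:R) (2 * Y) (2 * Y / q%:R).
- by apply: entropy_defect_ge0.
- rewrite divr_ge0//.
  by apply: sumr_ge0 => v _; apply: sumr_ge0 => w _; rewrite !mulr_ge0.
- by rewrite mulr_gt0.
- by [].
- by rewrite words_T.
- by rewrite words_T.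
- by rewrite words_T mulrAC.
set c : R := (extensions e (q.*2 - i) s)%:R in cs def_s step_s.
have a_sum : \sum_v a s v = c by rewrite extensions_natr_sum// ltnW.
have a0 v : 0 <= a s v by [].
pose heavy v := M * c < a s v * n.
(* The defect is at most [6 * Y * c] and [ln M = 12 * Y + 2], so the heavy mass is at most
   [(6 * Y + 1) * c / (12 * Y + 2) = c / 2]. *)
have heavy_le : \sum_(v | heavy v) a s v <= c / 2.
  have := heavy_mass_le a0 M0; rewrite a_sum -/n /heavy expRK.
  set h := \sum_(v | _) _ => le_h.
  have L0 : 0 < 12 * Y + 2 by lra.
  by rewrite -(ler_pM2r L0); apply: (le_trans le_h); lra.
have light_ge : c / 2 <= \sum_(v | ~~ heavy v) a s v.
  by move: a_sum; rewrite (bigID heavy)/=; lra.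
(* The scaling that brings light atoms, those with [a s v <= M * c / n], into the unit interval. *)
pose t := n / (M * c).
have t0 : 0 < t by rewrite divr_gt0// mulr_gt0.
pose p v : R := if heavy v then 0 else a s v * t.
have p01 v : 0 <= p v <= 1.
  rewrite /p; case: ifPn => [_|]; first by rewrite lexx ler01.
  rewrite /heavy -leNgt => light; rewrite mulr_ge0 ?(ltW t0)//=.
  by rewrite /t mulrA ler_pdivrMr ?mul1r// mulr_gt0.
have p_sum : n / M <= 2 * \sum_v p v.
  have -> : \sum_v p v = (\sum_(v | ~~ heavy v) a s v) * t.
    rewrite mulr_suml [RHS]big_mkcond; apply: eq_bigr => v _.
    by rewrite /p; case: (heavy v).
  have -> : n / M = 2 * (c / 2 * t).
    by rewrite /t; field; rewrite !gt_eqF.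
  by rewrite ler_pM2l// ler_pM2r.
have nM0 : 0 < n / M by rewrite divr_gt0.
have p_sum0 : 0 <= \sum_v p v by apply: sumr_ge0 => v _; case/andP: (p01 v).
have p_sqr : (n / M) ^+ 2 <= 4 * (\sum_v p v) ^+ 2.
  have -> : 4 * (\sum_v p v) ^+ 2 = (2 * \sum_v p v) ^+ 2 by ring.
  by rewrite ler_pXn2r ?nnegrE ?(ltW nM0) ?mulr_ge0.
have p_sparse : \sum_v \sum_w (~~ e v w)%:R * (p v * p w)
    <= eps / 2 * (\sum_v p v) ^+ 2.
  apply: (@le_trans _ _ (eps / 8 * (n / M) ^+ 2)); last first.
    by have := ler_wpM2l (ltW eps0) p_sqr; lra.
  apply: (@le_trans _ _
      ((\sum_v \sum_w (~~ e v w)%:R * (a s v * a s w)) * t ^+ 2)).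
    rewrite mulr_suml; apply: ler_sum => v _.
    rewrite mulr_suml; apply: ler_sum => w _.
    have p_le x : 0 <= p x <= a s x * t.
      by rewrite /p; case: (heavy x); rewrite ?lexx ?andbT /= mulr_ge0 ?(ltW t0).
    have /andP[pv0 pv] := p_le v; have /andP[pw0 pw] := p_le w.
    rewrite -mulrA ler_wpM2l//.
    have -> : a s v * a s w * t ^+ 2 = a s v * t * (a s w * t) by ring.
    exact: ler_pM.
  have -> : (n / M) ^+ 2 = c ^+ 2 * t ^+ 2.
    by rewrite /t; field; rewrite !gt_eqF.
  rewrite mulrA ler_pM2r ?exprn_gt0//.
  move: step_s; rewrite ler_pdivrMr// => /le_trans; apply.
  (* The constant [48] enters here: it gives [6 * Y / q%:R <= eps / 8]. *)
  have -> : 3 * (2 * Y / q%:R) * c * c = 6 * Y / q%:R * c ^+ 2 by ring.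
  rewrite ler_pM2r ?exprn_gt0//.
  by rewrite ler_pdivrMr//; move: q_large; rewrite -/Y; lra.
have [S [S_dense S_large]] := near_clique_rounding e_irr eps0 eps1 p01 p_sparse.
exists S; split=> //; rewrite -/n -/M.
rewrite -mulrA mulrCA mulrC -ler_pdivrMr//.
rewrite -(@ler_pXn2r _ 2)// ?nnegrE ?(ltW nM0) ?mulr_ge0//.
(* Squared sizes lose a factor [4 * 2 = 8], which is below [3 ^+ 2]. *)
apply: (le_trans p_sqr); rewrite [leRHS]exprMn.
have : 0 <= #|S|%:R ^+ 2 :> R by rewrite sqr_ge0.
have -> : 3 ^+ 2 = 9 :> R by ring.
lra.
Qed.

(** * Double counting of homogeneous sets *)

(** Factor by factor, [(m - i) / (n - i) <= m / n]. *)
Lemma expn_bin_le (k m n : nat) :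
  (m <= n)%N -> (n ^ k * 'C(m, k) <= m ^ k * 'C(n, k))%N.
Proof.
move=> mn; rewrite -(leq_pmul2r (fact_gt0 k)) -!mulnA !bin_ffact.
elim: k => [|k IHk]; first by rewrite !expn0 !ffactn0.
rewrite !ffactnSr !expnSr.
have : (n * (m - k) <= m * (n - k))%N.
  by rewrite !mulnBr mulnC leq_sub2l// leq_mul2r mn orbT.
by move/(leq_mul IHk); rewrite !mulnA -!(mulnAC _ n) -!(mulnAC _ m).
Qed.

Lemma bin_trinomial (k m n : nat) : (k <= m)%N -> (m <= n)%N ->
  ('C(n, m) * 'C(m, k) = 'C(n, k) * 'C(n - k, m - k))%N.
Proof.
move=> km mn; have kn := leq_trans km mn.
have f0 : (0 < k`! * (m - k)`! * (n - m)`!)%N by rewrite !muln_gt0 !fact_gt0.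
apply/eqP; rewrite -(eqn_pmul2r f0); apply/eqP.
have := bin_fact kn; have := bin_fact mn; have := bin_fact km.
have := @bin_fact (n - k) (m - k) (leq_sub2r k mn); rewrite subnBA// subnK//.
move=> E1 E2 E3 E4.
transitivity n`!.
  by rewrite -E3 -E2 !mulnA.
rewrite -E4 -E1 !mulnA; congr (_ * _)%N; ring.
Qed.

(* Double counting: each [k]-set lies in ['C(n - k, m - k)] of the [m]-sets. *)
Lemma card_sets_hit (V : finType) (P : pred {set V}) (k m : nat) :
  (k <= m)%N -> (m <= #|V|)%N ->
  (forall A : {set V}, #|A| = m -> exists B : {set V}, [/\ B \subset A, #|B| = k & P B]) ->
  (#|V| ^ k <= m ^ k * #|[set B : {set V} | P B & #|B| == k]|)%N.
Proof.
move=> km mn hit; set n := #|V|; set h := #|_|.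
have kn : (k <= n)%N := leq_trans km mn.
have supersets (B : {set V}) : #|B| = k ->
    #|[set A : {set V} | B \subset A & #|A| == m]| = 'C(n - k, m - k).
  move=> Bk; have nB : #|~: B| = (n - k)%N by rewrite /n -(cardsC B) Bk addKn.
  (* Complementation turns supersets of [B] into subsets of [~: B] of size [n - m]. *)
  rewrite -(card_imset _ (can_inj (@setCK V))).
  have -> : [set ~: A | A in [set A : {set V} | B \subset A & #|A| == m]] =
      [set A : {set V} | A \subset ~: B & #|A| == n - m]%N.
    apply/setP => A; rewrite inE; apply/imsetP/andP => [[A']|[AB /eqP Am]].
      rewrite inE => /andP[BA /eqP A'm] ->; rewrite setCS BA; split=> //.
      by rewrite /n -(cardsC A') A'm addKn.
    exists (~: A); last by rewrite setCK.
    rewrite inE -[B]setCK setCS AB /=.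
    have := cardsC A; rewrite Am -/n => nE.
    by rewrite -(eqn_add2l (n - m)%N) nE subnK.
  rewrite cards_draws nB -bin_sub; last by rewrite leq_sub2l.
  by congr 'C(_, _); lia.
have double_count : ('C(n, m) <= h * 'C(n - k, m - k))%N.
  rewrite -card_draws -sum1_card.
  apply: (@leq_trans (\sum_(A in [set A : {set V} | #|A| == m])
      \sum_(B in [set B : {set V} | P B & #|B| == k]) (B \subset A))%N).
    apply: leq_sum => A; rewrite inE => /eqP/hit[B [BA Bk PB]].
    by rewrite (bigD1 B) ?inE ?PB ?Bk ?eqxx//= BA.
  rewrite exchange_big /h -sum_nat_const; apply: leq_sum => B /=.
  rewrite inE => /andP[_ /eqP/supersets <-].
  rewrite -sum1_card [leqLHS]big_mkcond [leqRHS]big_mkcond; apply: leq_sum => A _.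
  by rewrite !inE; case: (_ \subset _); case: eqP.
have C0 : (0 < 'C(n - k, m - k))%N by rewrite bin_gt0 leq_sub2r.
have C1 : (0 < 'C(m, k))%N by rewrite bin_gt0.
(* By the trinomial identity, ['C(n, m) / 'C(n - k, m - k)] equals ['C(n, k) / 'C(m, k)]. *)
have nk : ('C(n, k) <= h * 'C(m, k))%N.
  rewrite -(leq_pmul2r C0) -bin_trinomial// [leqRHS]mulnAC.
  by rewrite leq_mul2r double_count orbT.
rewrite -(leq_pmul2r C1); apply: leq_trans (expn_bin_le k mn) _.
by rewrite -mulnA leq_mul2l nk orbT.
Qed.

(** * Complements, pair counts and edge density *)

Definition coadj (G : sgraph) : rel G := fun x y => (x != y) && ~~ adj x y.

Lemma coadj_sym (G : sgraph) : symmetric (@coadj G).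
Proof. by move=> x y; rewrite /coadj eq_sym adj_sym. Qed.

Lemma coadj_irrefl (G : sgraph) : irreflexive (@coadj G).
Proof. by move=> x; rewrite /coadj eqxx. Qed.

Lemma pairwise_enum (V : finType) (e : rel V) (B : {set V}) :
  {in B &, forall x y, x != y -> e x y} -> pairwise e (enum B).
Proof.
move=> eB; have : {in enum B &, forall x y, x != y -> e x y}.
  by move=> x y; rewrite !mem_enum; exact: eB.
elim: (enum B) (enum_uniq B) => //= x s IHs /andP[xs us] es.
apply/andP; split.
  apply/allP => y ys; apply: es; rewrite ?mem_head// ?inE ?ys ?orbT//.
  by apply: contraNneq xs => ->.
by apply: IHs => // y z ys zs; apply: es; rewrite inE ?ys ?zs orbT.
Qed.

(** Exact homogeneity, as opposed to [homogeneous eps], phrased with [pairwise] to match the words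
    counted by [extensions]. *)
Definition homogeneous_set (G : sgraph) : pred {set G} :=
  fun B => pairwise (@adj G) (enum B) || pairwise (@coadj G) (enum B).

Lemma hom_number_attained (G : sgraph) :
  exists2 B : {set G}, clique B || independent B & #|B| = hom_number G.
Proof.
have h0 : clique (set0 : {set G}) || independent (set0 : {set G}).
  by apply/orP; right; apply/forall_inP => x; rewrite inE.
rewrite /hom_number (bigop.bigmax_eq_arg (set0 : {set G}))//.
by case: arg_maxnP => // B hB _; exists B.
Qed.

Lemma subset_of_card (V : finType) (A : {set V}) (k : nat) :
  (k <= #|A|)%N -> exists2 B : {set V}, B \subset A & #|B| = k.
Proof.
move=> kA; have : (0 < #|[set B : {set V} | B \subset A & #|B| == k]|)%N.
  by rewrite cards_draws bin_gt0.
by case/card_gt0P => B; rewrite inE => /andP[BA /eqP Bk]; exists B.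
Qed.

Lemma homogeneous_subset (G : sgraph) (A : {set G}) (k : nat) :
  (k <= hom_number (induced A))%N ->
  exists B : {set G}, [/\ B \subset A, #|B| = k & homogeneous_set B].
Proof.
have [B homB <-] := hom_number_attained (induced A).
case/subset_of_card => B' /subsetP B'B <-; exists [set val x | x in B'].
split; last 1 first.
- case/orP: homB => homB; apply/orP; [left|right]; apply: pairwise_enum => _ _
    /imsetP[x /B'B xB ->] /imsetP[y /B'B yB ->] xy.
  + have /forall_inP/(_ x xB)/forall_inP/(_ y yB)/implyP := homB; apply.
    by apply: contraNneq xy => ->.
  + rewrite /coadj xy /=.
    by have /forall_inP/(_ x xB)/forall_inP/(_ y yB) := homB.
- by apply/subsetP => _ /imsetP[x _ ->]; exact: valP.
- by rewrite card_imset//; exact: val_inj.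
Qed.

Lemma card_edges (G : sgraph) :
  (#|edges G| * 2 = \sum_(x : G) \sum_(y : G) adj x y)%N.
Proof.
pose A := [set p : G * G | adj p.1 p.2].
have -> : (\sum_(x : G) \sum_(y : G) adj x y = #|A|)%N.
  rewrite pair_big -sum1_card [RHS]big_mkcond; apply: eq_bigr => p _.
  by rewrite inE; case: adj.
rewrite -[RHS]sum1_card (partition_big (fun p => [set p.1; p.2]) (mem (edges G)))/=.
  rewrite -sum_nat_const; apply: eq_bigr => E; rewrite inE.
  case/existsP=> x /existsP[y /andP[xy /eqP->]].
  have yx : y != x by apply: contraTneq xy => ->; rewrite adj_irrefl.
  rewrite sum1dep_card; transitivity #|[set (x, y); (y, x)]|.
    by rewrite cards2 xpair_eqE negb_and eq_sym yx.
  apply: eq_card => -[a b]; rewrite !inE /= !xpair_eqE; apply/esym.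
  apply/andP/orP => [[ab /eqP abE]|].
    have := set21 a b; have := set22 a b; rewrite abE !inE.
    move=> /orP[]/eqP bE /orP[]/eqP aE; move: ab abE; rewrite aE bE ?adj_irrefl//.
    - by move=> _ _; right; rewrite !eqxx.
    - by move=> _ _; left; rewrite !eqxx.
  by case=> /andP[/eqP-> /eqP->]; [rewrite xy|rewrite adj_sym xy setUC].
move=> [x y]; rewrite !inE /= => xy.
by apply/existsP; exists x; apply/existsP; exists y; rewrite xy /=.
Qed.

Definition pair_count (V : finType) (e : rel V) (S : {set V}) : nat :=
  \sum_(v in S) \sum_(w in S | w != v) e v w.

Lemma pair_count_split (V : finType) (e e' : rel V) (S : {set V}) :
  (forall v w, w != v -> e' v w = ~~ e v w) ->
  (pair_count e S + pair_count e' S = #|S| * #|S|.-1)%N.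
Proof.
move=> ee'; rewrite -big_split -sum_nat_const; apply: eq_bigr => v vS /=.
have -> : #|S|.-1 = #|[pred w in S | w != v]|.
  by rewrite (cardsD1 v S) vS /= -cardsE; apply: eq_card => w; rewrite !inE andbC.
rewrite -big_split -sum1_card; apply: eq_bigr => w /andP[_ wv] /=.
by rewrite ee'//; case: (e v w).
Qed.

Lemma pair_count_eq (V : finType) (e e' : rel V) (S : {set V}) :
  (forall v w, w != v -> e v w = e' v w) -> pair_count e S = pair_count e' S.
Proof.
move=> ee'; apply: eq_bigr => v _; apply: eq_bigr => w /andP[_ wv].
by rewrite ee'.
Qed.

Lemma coadjN (G : sgraph) (x y : G) : y != x -> coadj x y = ~~ adj x y.
Proof. by move=> yx; rewrite /coadj eq_sym yx. Qed.

Lemma density_pair_count (R : realType) (G : sgraph) (S : {set G}) :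
  density R (induced S) * (#|S| * #|S|.-1)%:R = (pair_count (@adj G) S)%:R.
Proof.
have card_S : #|induced S| = #|S| by rewrite card_sig.
have bin_S : ('C(#|S|, 2) * 2 = #|S| * #|S|.-1)%N.
  by rewrite -[X in (_ * X)%N]/(2`!) bin_ffact ffactnS ffactn1.
have edges_S : (#|edges (induced S)| * 2 = pair_count (@adj G) S)%N.
  rewrite card_edges /pair_count [RHS]big_sub; apply: eq_bigr => x _ /=.
  rewrite [RHS]big_mkcondr [RHS]big_sub; apply: eq_bigr => y _.
  by rewrite /= /induced_adj; case: (eqVneq (val y)) => [->|_]//; rewrite adj_irrefl.
rewrite /density card_S -bin_S -edges_S !natrM mulrA.
(* With at most one vertex there are no pairs, and both sides are [0]. *)
have [C0|C0] := eqVneq 'C(#|S|, 2) 0%N; last by rewrite divfK// pnatr_eq0.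
rewrite C0 mulr0 mul0r.
have := pair_count_split S (@coadjN G); rewrite -bin_S C0 mul0n -edges_S.
by move/eqP; rewrite addn_eq0 muln_eq0 => /andP[/orP[/eqP->|//] _]; rewrite mul0r.
Qed.

Lemma homogeneous_small (R : realType) (eps : R) (G : sgraph) (S : {set G}) :
  0 <= eps -> (#|S| <= 1)%N -> homogeneous eps S.
Proof.
move=> eps0 S1; left; rewrite /density.
have -> : #|induced S| = #|S| by rewrite card_sig.
by rewrite bin_small// invr0 mulr0.
Qed.

Lemma homogeneous_of_pair_count (R : realType) (eps : R) (G : sgraph)
    (e : rel G) (S : {set G}) :
  e = @adj G \/ e = @coadj G -> 0 <= eps ->
  (pair_count (fun v w => ~~ e v w) S)%:R <= eps * (#|S| * #|S|.-1)%:R ->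
  homogeneous eps S.
Proof.
move=> eE eps0; have [S1 _|S1] := leqP #|S| 1; first exact: homogeneous_small.
have S0 : 0 < (#|S| * #|S|.-1)%:R :> R by rewrite ltr0n muln_gt0 -!subn1 subn_gt0 S1 ltnW.
case: eE => -> sparse; [right|left]; rewrite -(ler_pM2r S0) density_pair_count.
  have := @pair_count_split _ (@adj G) (fun v w => ~~ adj v w) S (fun _ _ _ => erefl).
  by move/(congr1 (fun k => k%:R : R)); rewrite natrD; lra.
apply: le_trans sparse; rewrite ler_nat; apply/eq_leq/pair_count_eq => v w wv.
by rewrite coadjN// negbK.
Qed.

Lemma pair_count_of_homogeneous (R : realType) (eps : R) (G : sgraph)
    (S : {set G}) :
  homogeneous eps S ->
  exists2 e : rel G, e = @adj G \/ e = @coadj G &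
    (pair_count e S)%:R <= eps * (#|S| * #|S|.-1)%:R.
Proof.
have S0 : 0 <= (#|S| * #|S|.-1)%:R :> R by [].
case=> dens; [exists (@adj G); first by left|exists (@coadj G); first by right].
  by rewrite -density_pair_count ler_wpM2r.
have := ler_wpM2r S0 dens; rewrite density_pair_count mulrBl mul1r.
have /(congr1 (fun k => k%:R : R)) := pair_count_split S (@coadjN G).
by rewrite natrD; lra.
Qed.

(* Half of [S] has at most twice the average degree; a maximal independent
   subset of that half dominates it. *)
Lemma large_independent (R : realType) (V : finType) (e : rel V) (S : {set V})
    (eps : R) :
  symmetric e -> 0 < eps ->
  (pair_count e S)%:R <= eps * (#|S| * #|S|.-1)%:R ->
  exists2 I : {set V}, {in I &, forall x y, x != y -> ~~ e x y} &
    #|S|%:R <= 2 * #|I|%:R * (2 * eps * #|S|%:R + 1).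
Proof.
move=> e_sym eps0 sparse.
have [->|[v0 v0S]] := set_0Vmem S.
  by exists set0 => [x y|]; rewrite ?inE// cards0 mulr0 mul0r.
have s0 : 0 < #|S|%:R :> R by rewrite ltr0n; apply/card_gt0P; exists v0.
set s : R := #|S|%:R in s0 *.
pose deg v : R := (\sum_(w in S | w != v) e v w)%:R.
pose low := [set v in S | deg v <= 2 * eps * s].
have low_large : s <= 2 * #|low|%:R.
  have high_few : #|S :\: low|%:R * (2 * eps * s) <= eps * s * s.
    apply: (@le_trans _ _ (pair_count e S)%:R); last first.
      apply: (le_trans sparse); rewrite -mulrA ler_wpM2l ?(ltW eps0)// natrM.
      by rewrite ler_wpM2l// ler_nat leq_pred.
    rewrite natr_sum (bigID (mem low))/= mulr_natl -sumr_const.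
    apply: ler_wpDl; first by apply: sumr_ge0.
    rewrite [leLHS]big_mkcond [leRHS]big_mkcond; apply: ler_sum => v _.
    rewrite inE andbC; case: ifP => // /andP[vS].
    by rewrite inE vS /= -ltNge => /ltW.
  have sE : s = #|low|%:R + #|S :\: low|%:R.
    rewrite /s -(cardsID low S) natrD; congr (_%:R + _).
    by apply: eq_card => v; rewrite !inE; case: (v \in S).
  have : #|S :\: low|%:R * 2 <= s.
    rewrite -(ler_pM2r (mulr_gt0 eps0 s0)); move: high_few; lra.
  lra.
pose indep (I : {set V}) :=
  (I \subset low) && [forall x in I, forall y in I, (x != y) ==> ~~ e x y].
have indep0 : indep set0.
  by rewrite /indep sub0set; apply/forall_inP => x; rewrite inE.
have [I /maxsetP[/andP[/subsetP I_low I_ind] I_max] _] := maxset_exists indep0.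
have I_indP : {in I &, forall x y, x != y -> ~~ e x y}.
  by move=> x y xI yI; have /forall_inP/(_ x xI)/forall_inP/(_ y yI)/implyP := I_ind.
exists I => //; apply: (le_trans low_large).
rewrite -mulrA ler_pM2l//.
(* By maximality a low vertex lies in [I], which the summand [v == w] records, or has a neighbour in
   [I]. *)
have cover w : w \in low -> (1 <= \sum_(v in I) ((v == w) + (w != v) * e v w))%N.
  move=> w_low; have [wI|wI] := boolP (w \in I).
    by rewrite (bigD1 w)//= eqxx.
  have [/existsP[v /andP[vI vw]]|] := boolP [exists v, (v \in I) && e v w].
    by rewrite (bigD1 v)//= vw; case: eqVneq.
  rewrite negb_exists => /forallP nadj; case/negP: wI.
  have -> : I = w |: I; last by rewrite setU11.
  apply/esym/I_max; last exact: subsetU1.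
  apply/andP; split.
    by apply/subsetP => x; rewrite in_setU1 => /predU1P[->//|/I_low].
  have nadjP v : v \in I -> ~~ e v w by move=> vI; have := nadj v; rewrite vI.
  apply/forall_inP => x; rewrite in_setU1 => /predU1P[->|xI];
    apply/forall_inP => y; rewrite in_setU1 => /predU1P[->|yI]; apply/implyP.
  - by rewrite eqxx.
  - by rewrite e_sym nadjP.
  - by rewrite nadjP.
  - exact: I_indP.
have card_low : (#|low| <= \sum_(v in I) ((\sum_(w in S | w != v) e v w) + 1))%N.
  rewrite -sum1_card; apply: (leq_trans (leq_sum _ cover)).
  rewrite exchange_big; apply: leq_sum => v vI /=.
  rewrite big_split [leqLHS]addnC /= leq_add//.
    rewrite [leqLHS]big_mkcond [leqRHS]big_mkcond; apply: leq_sum => w _.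
    by rewrite inE; case: (w \in S); case: (_ <= _); case: eqP; rewrite ?mul1n.
  rewrite big_mkcond (bigD1 v)//= eqxx big1 => [|w /negbTE wv].
    by case: (v \in low).
  by rewrite eq_sym wv if_same.
apply: (@le_trans _ _ (\sum_(v in I) (deg v + 1))).
  have := card_low; rewrite -(ler_nat R) natr_sum => /le_trans; apply.
  by apply: ler_sum => v _; rewrite natrD.
rewrite mulr_natl -sumr_const; apply: ler_sum => v /I_low.
by rewrite inE lerD2r => /andP[].
Qed.

(** * From Erdős-Hajnal to polynomial Rödl *)

(** The real exponent [c] is traded for a natural number [N >= 1 / c], which suits counting. *)
Lemma hom_number_expn (R : realType) (F : sgraph -> Prop) :
  erdos_hajnal R F ->
  exists2 N, (0 < N)%N & forall G, F G -> (#|G| <= hom_number G ^ N)%N.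
Proof.
case=> c [c0 hom_ge]; exists (Num.truncn c^-1).+1 => // G /hom_ge.
set N := (Num.truncn c^-1).+1; have [->//|G0] := posnP #|G|.
move=> le_hom; rewrite -(ler_nat R) natrX -powR_mulrn//.
have Nc : 1 <= c * N%:R.
  have := truncnS_gt c^-1; rewrite -/N => /ltW /(ler_wpM2l (ltW c0)).
  by rewrite divff ?gt_eqF.
apply: (@le_trans _ _ (#|G|%:R `^ (c * N%:R))).
  by rewrite -{1}[_%:R]powRr1// ler_powR// ler1n.
by rewrite powRrM ge0_ler_powR ?nnegrE ?powR_ge0.
Qed.

(** By heredity every set of [k ^ N] vertices contains a homogeneous [k]-set, so [card_sets_hit]
    applies. The factor [2] comes from keeping the more frequent of the two kinds. *)
Lemma many_homogeneous_lists (F : sgraph -> Prop) (N k : nat) (G : sgraph) :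
  hereditary F -> (0 < N)%N -> (forall G, F G -> (#|G| <= hom_number G ^ N)%N) ->
  F G -> (0 < k)%N -> (k ^ N <= #|G|)%N ->
  exists2 e : rel G, e = @adj G \/ e = @coadj G &
    (#|G| ^ k <= 2 * (k ^ N) ^ k * extensions e k [::])%N.
Proof.
move=> F_her N0 F_hom FG k0 kG.
have k_le : (k <= k ^ N)%N.
  by case: N N0 {F_hom kG} => // N _; rewrite expnS leq_pmulr// expn_gt0 k0.
have hit (A : {set G}) : #|A| = (k ^ N)%N ->
    exists B : {set G}, [/\ B \subset A, #|B| = k & homogeneous_set B].
  move=> Ak; apply: homogeneous_subset; have := F_hom _ (F_her _ A FG).
  by rewrite card_sig Ak leq_exp2r.
have many := card_sets_hit k_le kG hit.
have two_kinds : (#|[set B : {set G} | homogeneous_set B & #|B| == k]| <=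
    extensions (@adj G) k [::] + extensions (@coadj G) k [::])%N.
  apply: leq_trans (leq_add (card_cliques_le_extensions _ k)
    (card_cliques_le_extensions _ k)).
  apply: leq_trans (leq_card_setU _ _); apply/subset_leq_card/subsetP => B.
  by rewrite !inE /homogeneous_set -andb_orl.
have [le_ac|/ltnW le_ca] := leqP (extensions (@adj G) k [::]) (extensions (@coadj G) k [::]).
  exists (@coadj G); first by right.
  apply: (leq_trans many); rewrite -mulnA mulnCA leq_mul2l.
  by apply/orP; right; apply: (leq_trans two_kinds); lia.
exists (@adj G); first by left.
apply: (leq_trans many); rewrite -mulnA mulnCA leq_mul2l.
by apply/orP; right; apply: (leq_trans two_kinds); lia.
Qed.

Lemma large_homogeneous_set (R : realType) (F : sgraph -> Prop) (N q : nat)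
    (eps : R) (G : sgraph) :
  hereditary F -> (0 < N)%N -> (forall G, F G -> (#|G| <= hom_number G ^ N)%N) ->
  0 < eps -> eps <= 1 -> (0 < q)%N ->
  48 * (ln (q.*2 ^ N)%:R + 1) <= q%:R * eps :> R -> F G ->
  exists S : {set G}, homogeneous eps S /\
    #|G|%:R <= 3 * expR (12 * (ln (q.*2 ^ N)%:R + 1) + 2) * #|S|%:R :> R.
Proof.
move=> F_her N0 F_hom eps0 eps1 q0 q_large FG; set m := (q.*2 ^ N)%N.
set M := expR _.
have [G0|/card_gt0P[v _]] := posnP #|G|.
  exists set0; split; last by rewrite G0 cards0 mulr0.
  by apply: homogeneous_small; rewrite ?cards0// ltW.
have k0 : (0 < q.*2)%N by rewrite double_gt0.
have m0 : (0 < m)%N by rewrite expn_gt0 k0.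
have mR : 0 < m%:R :> R by rewrite ltr0n.
have m1 : 1 <= m%:R :> R by rewrite ler1n.
(* Below [m] vertices a singleton is large enough, because [m <= M]. *)
have [Gm|mG] := ltnP #|G| m.
  exists [set v]; split; first by apply: homogeneous_small; rewrite ?cards1// ltW.
  rewrite cards1 mulr1; have lnm : 0 <= ln m%:R :> R by rewrite ln_ge0.
  have mM : m%:R <= M.
    by rewrite -[leLHS]lnK ?posrE// ler_expR; lra.
  have : #|G|%:R <= m%:R :> R by rewrite ler_nat ltnW.
  by have := lt_le_trans mR mM; lra.
have [e eE many] := many_homogeneous_lists F_her N0 F_hom FG k0 mG.
have [e_sym e_irr] : symmetric e /\ irreflexive e.
  by case: eE => ->; split; [exact: adj_sym|exact: adj_irrefl|exact: coadj_sym
    |exact: coadj_irrefl].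
have G0 : (0 < #|G|)%N by apply: leq_trans mG.
have many' : (#|G|%:R / m%:R) ^+ q.*2 <= 2 * (extensions e q.*2 [::])%:R :> R.
  rewrite expr_div_n ler_pdivrMr ?exprn_gt0// -!natrX -!natrM ler_nat.
  by rewrite mulnAC.
have [S [S_dense S_large]] :=
  near_clique_of_many_cliques e_sym e_irr eps0 eps1 q0 m1 G0 q_large many'.
exists S; split=> //; apply: (homogeneous_of_pair_count eE) => //; first exact: ltW.
apply: le_trans S_dense; rewrite natr_sum.
by under eq_bigr do rewrite natr_sum.
Qed.

Lemma polynomial_rodl_of_hom_number (R : realType) (F : sgraph -> Prop) (N : nat) :
  hereditary F -> (0 < N)%N -> (forall G, F G -> (#|G| <= hom_number G ^ N)%N) ->
  polynomial_rodl R F.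
Proof.
move=> F_her N0 F_hom; pose B := (96 * N)%N.
pose K : R := 3 * expR 14 * (4 * B%:R) ^+ (24 * N).
pose r := (Num.truncn K).+1.
(* The lost factor is [3 * expR 14 * b%:R ^+ (24 * N)] with [b] at most [4 * B / eps]. The exponent
   [24 * N] absorbs the powers of [1 / eps], and [r] absorbs the constant: [K <= 2 ^+ r] and
   [eps < 2^-1]. *)
exists (24 * N + r)%:R => eps eps0 eps_lt G FG.
have eps1 : eps <= 1 by lra.
pose t := (Num.truncn eps^-1).+1; pose b := (2 * (B * t))%N.
have t_gt : eps^-1 < t%:R by exact: truncnS_gt.
have inv0 : 0 < eps^-1 by rewrite invr_gt0.
have t_le : t%:R <= eps^-1 + 1.
  by rewrite -natr1 lerD2r truncn_le// ltW.
(* The number [q.*2] is the square of [b], so the crude bound [ln b <= b - 1] makes the logarithm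
   linear in [t], while [q * eps] is at least [2 * B ^ 2 * t]. *)
pose q := (2 * (B * t) ^ 2)%N.
have qE : (q.*2 = b ^ 2)%N by rewrite /q /b; lia.
have B0 : (0 < B)%N by rewrite muln_gt0.
have b0 : (0 < b)%N by rewrite !muln_gt0 N0.
have q0 : (0 < q)%N by rewrite muln_gt0 expn_gt0 muln_gt0 B0.
have bR : 0 < b%:R :> R by rewrite ltr0n.
have ln_m : ln (q.*2 ^ N)%:R = (2 * N)%:R * ln b%:R :> R.
  by rewrite qE -expnM natrX lnXn// mulr_natl.
have q_large : 48 * (ln (q.*2 ^ N)%:R + 1) <= q%:R * eps :> R.
  rewrite ln_m; have N1 : 1 <= N%:R :> R by rewrite ler1n.
  have ln_le : (2 * N)%:R * ln b%:R <= (2 * N)%:R * (b%:R - 1) :> R.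
    by rewrite ler_wpM2l// ln_le_sub1.
  have te : 1 <= t%:R * eps.
    by rewrite -ler_pdivrMr// div1r ltW.
  have Bt0 : 0 <= 2 * B%:R ^+ 2 * t%:R :> R by rewrite !mulr_ge0 ?exprn_ge0.
  apply: (@le_trans _ _ (2 * B%:R ^+ 2 * t%:R)).
    apply: (@le_trans _ _ (48 * ((2 * N)%:R * b%:R))).
      by rewrite ler_pM2l//; move: ln_le; rewrite natrM; lra.
    by rewrite le_eqVlt; apply/orP; left; apply/eqP; rewrite /b /B !natrM; ring.
  apply: (le_trans (ler_peMr Bt0 te)).
  by rewrite le_eqVlt /q natrM natrX natrM; apply/orP; left; apply/eqP; ring.
have [S [S_hom S_large]] := large_homogeneous_set F_her N0 F_hom eps0 eps1 q0 q_large FG.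
exists S; split=> //; rewrite powR_mulrn; last exact: ltW.
have epsn : 0 < eps ^+ (24 * N + r) by rewrite exprn_gt0.
apply: le_trans (ler_wpM2l (ltW epsn) S_large) _.
rewrite mulrA -[leRHS]mul1r ler_wpM2r//.
have -> : expR (12 * (ln (q.*2 ^ N)%:R + 1) + 2) = expR 14 * b%:R ^+ (24 * N) :> R.
  have -> : 12 * (ln (q.*2 ^ N)%:R + 1) + 2 = 14 + (24 * N)%:R * ln b%:R :> R.
    rewrite ln_m !natrM; ring.
  by rewrite expRD expRM_natl lnK// posrE.
have b_le : b%:R <= 4 * B%:R * eps^-1.
  have -> : b%:R = 2 * (B%:R * t%:R) :> R by rewrite /b natrM natrM.
  have -> : 4 * B%:R * eps^-1 = 2 * (B%:R * (2 * eps^-1)) by ring.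
  rewrite ler_pM2l// ler_pM2l ?ltr0n//.
  have : 1 <= eps^-1 by rewrite invf_ge1.
  lra.
have b_pow : b%:R ^+ (24 * N) * eps ^+ (24 * N) <= (4 * B%:R) ^+ (24 * N).
  rewrite -exprMn lerXn2r ?nnegrE ?mulr_ge0 ?(ltW eps0)//.
  by rewrite -ler_pdivlMr.
have K_le : K <= 2 ^+ r.
  apply: (@le_trans _ _ r%:R); first exact/ltW/truncnS_gt.
  by rewrite -natrX ler_nat ltnW// ltn_expl.
have eps_r : eps ^+ r * 2 ^+ r <= 1.
  by rewrite -exprMn exprn_ile1 ?mulr_ge0 ?(ltW eps0)//; lra.
apply: le_trans eps_r.
apply: le_trans (ler_wpM2l (exprn_ge0 r (ltW eps0)) K_le).
have := ler_wpM2l (mulr_ge0 (exprn_ge0 r (ltW eps0)) (expR_ge0 14)) b_pow.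
rewrite exprD /K; lra.
Qed.

(** * From polynomial Rödl to Erdős-Hajnal *)

Lemma hom_number_ge (G : sgraph) (S : {set G}) :
  clique S || independent S -> (#|S| <= hom_number G)%N.
Proof.
exact: (@leq_bigmax_cond _ (fun S => clique S || independent S) (fun S => #|S|)).
Qed.

Lemma hom_number_ge_min (G : sgraph) : (minn #|G| 2 <= hom_number G)%N.
Proof.
have [G1|G1] := leqP #|G| 1.
  have [->|/card_gt0P[v _]] := posnP #|G|; first by rewrite min0n.
  apply: (@leq_trans #|[set v]|); first by rewrite cards1 geq_min G1.
  apply: (@hom_number_ge _ [set v]); apply/orP; right.
  apply/forall_inP => x /set1P->; apply/forall_inP => y /set1P->.
  by rewrite adj_irrefl.
have [x [y xy]] : exists x, exists y : G, x != y.
  by case/card_gt1P: G1 => x [y [_ _ xy]]; exists x, y.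
rewrite (minn_idPr G1); apply: (@leq_trans #|[set x; y]|).
  by rewrite cards2 xy.
apply: (@hom_number_ge _ [set x; y]); case/boolP: (adj x y) => exy; apply/orP; [left|right];
  apply/forall_inP => a /set2P[]->; apply/forall_inP => b /set2P[]->;
  by rewrite ?adj_irrefl ?eqxx ?(adj_sym y x) ?exy ?implybT.
Qed.

Lemma erdos_hajnal_of_polynomial_rodl (R : realType) (F : sgraph -> Prop) :
  polynomial_rodl R F -> erdos_hajnal R F.
Proof.
(* Raising the exponent to [C >= 1] weakens the bound, as [eps < 1], and ensures [d <= 1 / 2]. *)
case=> C0 rodl; pose C := Num.max C0 1; pose d := (2 * C)^-1.
have C1 : 1 <= C by rewrite le_max lexx orbT.
have d0 : 0 < d by rewrite invr_gt0; lra.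
exists (d / 4); split=> [|G FG]; first by rewrite divr_gt0.
set n : R := #|G|%:R; set x := n `^ (d / 4).
have := hom_number_ge_min G; have [G1|G1] := leqP #|G| 1.
  rewrite (minn_idPl _)//; last exact: leqW.
  rewrite -(ler_nat R); apply: le_trans; rewrite /x /n.
  case: #|G| G1 => [|[|//]] _; last by rewrite powR1.
  by rewrite powR0// gt_eqF// divr_gt0.
rewrite (minn_idPr G1) -(ler_nat R) => hom2.
(* Two vertices always form a homogeneous set; from here on [x > 2], which beats the constants
   below. *)
have [x2|x2] := leP x 2; first exact: le_trans hom2.
have n0 : 0 < n by rewrite ltr0n ltnW.
have n1 : 1 <= n by rewrite ler1n ltnW.
have x4 : x ^+ 4 = n `^ d.
  by rewrite -powR_mulrn ?powR_ge0// -powRrM; congr (_ `^ _); field.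
(* Thus [eps] is [n]^ (- d)[and]eps [^ C] is [n]^ (- 2^-1)[, so]S[has at least]n [^ 2^-1 >= eps^-1]
   vertices. *)
pose eps := (x ^+ 4)^-1.
have x0 : 0 < x by lra.
have x4_ge : 8 * x <= x ^+ 4.
  rewrite exprSr ler_pM2r// -[8](_ : 2 ^+ 3 = _); last by ring.
  by rewrite lerXn2r ?nnegrE// ltW.
have x40 : 0 < x ^+ 4 by rewrite exprn_gt0.
have eps0 : 0 < eps by rewrite invr_gt0.
have eps_lt : eps < 2^-1 by rewrite ltf_pV2 ?posrE//; lra.
have [S [S_hom S_large]] := rodl eps eps0 eps_lt G FG.
have epsC : n `^ (- 2^-1) <= eps `^ C0.
  have -> : n `^ (- 2^-1) = eps `^ C.
    rewrite /eps x4 -powRN -powRrM; congr (_ `^ _).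
    by rewrite /d; field; rewrite gt_eqF//; lra.
  by rewrite ger_powR ?eps0 ?le_max ?lexx//=; lra.
have s_ge : eps^-1 <= #|S|%:R.
  apply: le_trans S_large; apply: le_trans (ler_wpM2r (ltW n0) epsC).
  rewrite /eps invrK x4 -[X in _ * X](powRr1 (ltW n0)) -powRD; last by rewrite (gt_eqF n0) /= implybT.
  apply: ler_powR => //; rewrite /d.
  have -> : - 2^-1 + 1 = 2^-1 :> R by lra.
  by rewrite lef_pV2 ?posrE//; lra.
have s0 : 0 < #|S|%:R :> R by rewrite (lt_le_trans _ s_ge)// invr_gt0.
have [e eE sparse] := pair_count_of_homogeneous S_hom.
have e_sym : symmetric e by case: eE => ->; [exact: adj_sym|exact: coadj_sym].
have [I I_ind I_large] := large_independent e_sym eps0 sparse.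
have I_hom : clique I || independent I.
  case: eE I_ind => -> I_ind; apply/orP; [right|left];
    apply/forall_inP => a aI; apply/forall_inP => b bI.
    by case: (eqVneq a b) => [->|ab]; [rewrite adj_irrefl|exact: I_ind].
  by apply/implyP => ab; have := I_ind a b aI bI ab; rewrite /coadj ab negbK.
have : #|I|%:R <= (hom_number G)%:R :> R by rewrite ler_nat hom_number_ge.
apply: le_trans.
(* This absorbs the [+ 1] of [large_independent], leaving [#|I|] at least [x ^+ 4 / 6], which
   exceeds [x]. *)
have eps_s : 1 <= eps * #|S|%:R by rewrite -ler_pdivrMl// mulr1.
have : #|S|%:R <= 6 * eps * #|I|%:R * #|S|%:R.
  apply: (le_trans I_large).
  have := ler_wpM2l (ler0n R #|I|) eps_s; lra.
rewrite -{1}[#|S|%:R]mul1r ler_pM2r// mulrAC -ler_pdivrMr//.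
by rewrite mul1r invrK; lra.
Qed.

Theorem theorem1p7 (R : realType) (F : sgraph -> Prop) (hF : hereditary F) :
  erdos_hajnal R F <-> polynomial_rodl R F.
Proof.
split; last exact: erdos_hajnal_of_polynomial_rodl.
by case/hom_number_expn => N N0; apply: polynomial_rodl_of_hom_number.
Qed.
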